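(* Let $\mathbf{S}$ be a transformation semigroup over a set $X$ whose set $\mathcal{S}(\mathbf{S})$ of unrepresentations is non-empty. For unrepresentations $\mathbf{X}_1=(X,\cdot^1)$, $\mathbf{X}_2=(X,\cdot^2)$, $\mathbf{X}_3=(X,\cdot^3)$ of $\mathbf{S}$, let $t(\mathbf{X}_1,\mathbf{X}_2,\mathbf{X}_3)$ be the set $X$ with multiplication $$x\cdot y=\bigl(\phi_{\mathbf{X}_2}^{-1}\phi_{\mathbf{X}_3}(x)\bigr)\cdot^1 y .$$ Then $t(\mathbf{X}_1,\mathbf{X}_2,\mathbf{X}_3)$ is again an unrepresentation of $\mathbf{S}$, and $(\mathcal{S}(\mathbf{S}),t)$ is a heap.
   Context: A transformation semigroup over $X$ is a subsemigroup $\mathbf{S}$ (with underlying set $S$) of $(\mathrm{End}(X),\circ)$, where $\mathrm{End}(X)$ is the set of all functions $X\to X$. For a semigroup $\mathbf{X}=(X,\cdot)$ the representing map is $\phi_{\mathbf{X}}(x)(y)=x\cdot y$; its image in $\mathrm{End}(X)$ is the representation of $\mathbf{X}$, and $\mathbf{X}$ is faithful if $\phi_{\mathbf{X}}$ is injective. An unrepresentation of $\mathbf{S}$ is a faithful semigroup with underlying set $X$ whose representation is $\mathbf{S}$; $\mathcal{S}(\mathbf{S})$ is the set of these. For $\mathbf{X}\in\mathcal{S}(\mathbf{S})$, $\phi_{\mathbf{X}}$ is regarded as a bijection $X\to S$. A heap is a pair $(H,t)$ with $H$ a non-empty set and $t\colon H\times H\times H\to H$ satisfying $t(x,x,y)=y=t(y,x,x)$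 and $t(v,w,t(x,y,z))=t(t(v,w,x),y,z)$ for all elements of $H$. *)

(* Defs.v *)
From mathcomp Require Import all_boot.
From mathcomp Require Import boolp classical_sets.

Set Implicit Arguments.
Unset Strict Implicit.
Unset Printing Implicit Defensive.

Local Open Scope classical_set_scope.

(* The empty set of functions is allowed as a transformation semigroup; it has
   an unrepresentation only if [X] is empty. *)
Definition transformation_semigroup (X : Type) (S : set (X -> X)) : Prop :=
  forall f g, S f -> S g -> S (f \o g).

Definition representing_map (X : Type) (mul : X -> X -> X) : X -> (X -> X) :=
  fun x y => mul x y.

Definition representation (X : Type) (mul : X -> X -> X) : set (X -> X) :=
  range (representing_map mul).

Definition faithful (X : Type) (mul : X -> X -> X) : Prop :=
  injective (representing_map mul).

(* A semigroup with underlying set [X] is given by its multiplication. *)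
Definition unrepresentations (X : Type) (S : set (X -> X)) :
    set (X -> X -> X) :=
  [set mul | [/\ associative mul, faithful mul & representation mul = S]].

Section RepresentingBijection.
Variables (X : Type) (S : set (X -> X)).
Implicit Type A : unrepresentations S.

Lemma representing_map_in A x : S (representing_map (val A) x).
Proof.
have [_ _ AS] := set_valP A.
suff : representation (val A) (representing_map (val A) x) by rewrite AS.
by exists x.
Qed.

(* The representing map of an unrepresentation, with codomain [S]. *)
Definition phi A (x : X) : S := SigSub (mem_set (representing_map_in A x)).

Lemma phi_surj A (s : S) : exists x, phi A x = s.
Proof.
have [_ _ AS] := set_valP A.
have : representation (val A) (val s) by rewrite AS; apply: set_valP.
by case=> x _ xs; exists x; apply: val_inj.
Qed.

Definition phi_inv A (s : S) : X := projT1 (cid (phi_surj A s)).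

Lemma phi_invK A : cancel (phi_inv A) (phi A).
Proof. by move=> s; rewrite /phi_inv; case: cid. Qed.

Lemma phiK A : cancel (phi A) (phi_inv A).
Proof.
have [_ Ainj _] := set_valP A.
by move=> x; apply: Ainj; have /(congr1 val) := phi_invK A (phi A x).
Qed.

Definition t_mul (A1 A2 A3 : unrepresentations S) : X -> X -> X :=
  fun x y => val A1 (phi_inv A2 (phi A3 x)) y.

End RepresentingBijection.

Definition is_heap (H : Type) (t : H -> H -> H -> H) : Prop :=
  [/\ inhabited H,
      forall x y, t x x y = y /\ y = t y x x
    & forall v w x y z, t v w (t x y z) = t (t v w x) y z].

(* Main.v *)
Require Import Defs.
From mathcomp Require Import all_boot.
From mathcomp Require Import boolp classical_sets.

Local Open Scope classical_set_scope.

(* Associativity of an unrepresentation says exactly that its representing map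
   [phi A] intertwines the action of [S] on [X] by evaluation with the action
   of [S] on itself by left composition. Hence every [phi_inv B \o phi C]
   commutes with [S], which makes [phi A \o phi_inv B \o phi C] the representing
   map of an associative product. The heap laws are then those of
   [f \o g^-1 \o h] for bijections. *)

Lemma phi_equivariant (X : Type) (S : set (X -> X)) (A : unrepresentations S)
    (f : X -> X) (y : X) :
  S f -> val (phi A (f y)) = f \o val (phi A y).
Proof.
have [Aassoc _ AS] := set_valP A.
rewrite -[in X in X -> _]AS => -[z _ <-].
by apply/funext => u; rewrite /= /representing_map Aassoc.
Qed.

Lemma phi_inv_phi_commute (X : Type) (S : set (X -> X))
    (B C : unrepresentations S) (f : X -> X) (y : X) :
  S f -> phi_inv B (phi C (f y)) = f (phi_inv B (phi C y)).
Proof.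
(* Under the injective [phi B], equivariance turns both sides into [f \o val (phi C y)]. *)
move=> Sf; apply: (can_inj (phiK B)); apply: val_inj.
by rewrite phi_invK !phi_equivariant// phi_invK.
Qed.

Lemma representing_map_t_mul (X : Type) (S : set (X -> X))
    (A B C : unrepresentations S) (x : X) :
  representing_map (t_mul A B C) x = val (phi A (phi_inv B (phi C x))).
Proof. by []. Qed.

Lemma t_mul_unrepresentation (X : Type) (S : set (X -> X))
    (A B C : unrepresentations S) :
  unrepresentations S (t_mul A B C).
Proof.
split.
- move=> x y z; have St := representing_map_in A (phi_inv B (phi C x)).
  (* With [f] the left multiplication by [x], equivariance of [phi A] absorbs [f] into its argument,
     and commutation then moves [f] onto [y]. *)
  rewrite -[LHS]/((val (phi A (phi_inv B (phi C x))) \o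
                   val (phi A (phi_inv B (phi C y)))) z).
  rewrite -phi_equivariant//.
  by rewrite -(@phi_inv_phi_commute _ _ B C _ y).
- move=> x y; rewrite !representing_map_t_mul => /val_inj.
  by move=> /(can_inj (phiK A))/(can_inj (phi_invK B))/(can_inj (phiK C)).
- apply/seteqP; split=> [_ [x _ <-]|f Sf].
    exact: representing_map_in.
  pose s : S := SigSub (mem_set Sf).
  (* The witness inverts the three bijections in turn. *)
  exists (phi_inv C (phi B (phi_inv A s))) => //.
  by rewrite representing_map_t_mul phi_invK phiK phi_invK.
Qed.

Lemma phi_t_mul (X : Type) (S : set (X -> X)) (A B C : unrepresentations S)
    (x : X) :
  phi (SigSub (mem_set (t_mul_unrepresentation _ _ A B C))
       : unrepresentations S) x = phi A (phi_inv B (phi C x)).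
Proof. exact: val_inj. Qed.

(** The representing map is the curried product, so heap laws can be checked on [phi]. *)
Lemma eq_unrepresentation (X : Type) (S : set (X -> X))
    (A B : unrepresentations S) :
  phi A =1 phi B -> A = B.
Proof.
by move=> AB; apply: val_inj; apply/funext => x; have /(congr1 val) := AB x.
Qed.

Theorem corollary3p6 (X : Type) (S : set (X -> X))
  (S_semigroup : transformation_semigroup S)
  (S_unrep : unrepresentations S !=set0) :
  exists t_unrep : forall A1 A2 A3 : unrepresentations S,
      unrepresentations S (t_mul A1 A2 A3),
    is_heap (fun A1 A2 A3 : unrepresentations S =>
      SigSub (mem_set (t_unrep A1 A2 A3)) : unrepresentations S).
Proof.
exists (t_mul_unrepresentation X S); split.
- by case: S_unrep => m Sm; exists; exact: (SigSub (mem_set Sm)).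
- move=> A B; split; apply: eq_unrepresentation => x.
    by rewrite phi_t_mul phi_invK.
  by rewrite phi_t_mul phiK.
- move=> A B C D E; apply: eq_unrepresentation => x.
  (* Both bracketings unfold to the same five-fold alternating composite. *)
  by rewrite !phi_t_mul.
Qed.
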